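(* Define integers $b_{\mathcal{G}}(n)$, $n\ge0$, by $b_{\mathcal{G}}(0)=1$, $b_{\mathcal{G}}(1)=-1$, $b_{\mathcal{G}}(2)=-1$ and, for $n\ge 3$, $$b_{\mathcal{G}}(n)=-\frac12\left(\sum_{k=0}^{n-2}b_{\mathcal{G}}(k)\binom{n}{k+1}+\sum_{k=0}^{n-1}b_{\mathcal{G}}(k)\binom{n+1}{k+1}\right).$$ Let $\widetilde{G}(x)=x\frac{e^x-1}{e^x+1}=x\tanh(x/2)$. Then $\widetilde{G}^{(2n-1)}(0)=0$ and $\widetilde{G}^{(2n)}(0)=b_{\mathcal{G}}(2n-2)$ for all $n\ge 1$. *)

(* Defs.v *)
(* Stdlib reals with Coquelicot derivatives. *)
From Stdlib Require Import Reals Arith Lia.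
From Coquelicot Require Import Coquelicot.
Open Scope R_scope.

(* The right-hand side of the recurrence for index [n >= 3]; [sum_f_R0 f m]
   is [f 0 + ... + f m].  [Binomial.C] is qualified because Coquelicot's [C]
   is the type of complex numbers. *)
Definition bG_step (b : nat -> R) (n : nat) : R :=
  - (1 / 2) *
    (sum_f_R0 (fun k => b k * Binomial.C n (k + 1)) (n - 2) +
     sum_f_R0 (fun k => b k * Binomial.C (n + 1) (k + 1)) (n - 1)).

(* Course-of-values recursion: [bG_upto n] is the sequence tabulated correctly
   on indices [<= n].  The values are taken in [R] because of the factor 1/2;
   that they are integers is part of what is to be proved. *)
Fixpoint bG_upto (n : nat) : nat -> R :=
  match n with
  | 0%nat => fun _ => 1
  | S m => fun k =>
      if (k <=? m)%nat then bG_upto m k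
      else match m with
           | 0%nat | 1%nat => -1
           | _ => bG_step (bG_upto m) n
           end
  end.

Definition bG (n : nat) : R := bG_upto n n.

Definition Gtilde (x : R) : R := x * ((exp x - 1) / (exp x + 1)).

Lemma bG_upto_bG (n k : nat) : (k <= n)%nat -> bG_upto n k = bG k.
Proof.
induction n as [|n IH]; intros Hk.
- now replace k with 0%nat by lia.
- destruct (Nat.eq_dec k (S n)) as [->|Hne]; [reflexivity|].
  cbn [bG_upto].
  replace (k <=? n)%nat with true by (symmetry; apply Nat.leb_le; lia).
  apply IH; lia.
Qed.

Lemma bG_0 : bG 0 = 1. Proof. reflexivity. Qed.
Lemma bG_1 : bG 1 = -1. Proof. reflexivity. Qed.
Lemma bG_2 : bG 2 = -1. Proof. reflexivity. Qed.

Lemma bG_rec (n : nat) : (3 <= n)%nat ->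
  bG n =
  - (1 / 2) *
    (sum_f_R0 (fun k => bG k * Binomial.C n (k + 1)) (n - 2) +
     sum_f_R0 (fun k => bG k * Binomial.C (n + 1) (k + 1)) (n - 1)).
Proof.
intros Hn; destruct n as [|[|[|m]]]; try lia.
unfold bG at 1; cbn [bG_upto].
replace (S (S (S m)) <=? S (S m))%nat with false
  by (symmetry; apply Nat.leb_gt; lia).
change (bG_step (bG_upto (S (S m))) (S (S (S m))) =
        bG_step bG (S (S (S m)))).
unfold bG_step; f_equal; f_equal;
  apply sum_eq; intros i Hi; rewrite bG_upto_bG; trivial; lia.
Qed.

(* Main.v *)
Require Import Defs.
From Stdlib Require Import Reals Arith Lra Lia FunctionalExtensionality.
From Coquelicot Require Import Coquelicot.
Open Scope R_scope.

(** Write [g n] for the [n]-th derivative of [Gtilde] at [0], [S] for the shift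
    of sequences and [E] for the binomial transform, so that [S E = E (S + 1)].
    Differentiating [(exp x + 1) Gtilde x = x (exp x - 1)] gives
    [(E g) n + g n = n] for [n >= 2].

    Put [c n = g (n+1) + g (n+2)] for [n >= 1] and [c 0 = 0].  Then
    [(E c) n = g (n+1) - g (n+2)], hence
    [c (n+1) - c n + (E c) n + (E c) (n+1) = 0], which is the recurrence of
    [bG] after an index shift; so [bG n = g (n+2) + g (n+3)].  As [Gtilde] is
    even, one of the two terms vanishes.

    Integrality does not follow from [2 g n = n - ...] directly.  Applying
    [S^n (S - 1)^n] to [E g + g] yields [((S+1)^n + (S-1)^n) S^n g = 0] at [0]
    for [n >= 2], where the factor [2] cancels and [g (2n)] becomes an integral
    combination of [g n, ..., g (2n-1)]. *)

(** * The binomial transform *)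

Definition binT (a : nat -> R) (n : nat) : R :=
  sum_f_R0 (fun k => a k * Binomial.C n k) n.

(* The operator [S + c], where [S] is the shift. *)
Definition sadd (c : R) (a : nat -> R) : nat -> R :=
  fun k => a (S k) + c * a k.

Lemma C_n_0 (n : nat) : Binomial.C n 0 = 1.
Proof.
unfold Binomial.C; rewrite Nat.sub_0_r; simpl (INR (Factorial.fact 0)).
field; apply INR_fact_neq_0.
Qed.

Lemma C_n_n (n : nat) : Binomial.C n n = 1.
Proof.
unfold Binomial.C; rewrite Nat.sub_diag; simpl (INR (Factorial.fact 0)).
field; apply INR_fact_neq_0.
Qed.

Lemma binT_0 (a : nat -> R) : binT a 0 = a 0%nat.
Proof. unfold binT; simpl; rewrite C_n_0; ring. Qed.

Lemma binT_plus (a b : nat -> R) (n : nat) :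
  binT (fun k => a k + b k) n = binT a n + binT b n.
Proof.
unfold binT; rewrite <- sum_plus; apply sum_eq; intros; ring.
Qed.

Lemma binT_scal (c : R) (a : nat -> R) (n : nat) :
  binT (fun k => c * a k) n = c * binT a n.
Proof.
unfold binT; rewrite scal_sum; apply sum_eq; intros; ring.
Qed.

(** Pascal's rule; this is the relation [S E = E (S + 1)]. *)
Lemma binT_S (a : nat -> R) (n : nat) :
  binT a (S n) = binT (fun k => a (S k)) n + binT a n.
Proof.
destruct n as [|m].
- rewrite !binT_0; unfold binT; simpl.
  rewrite C_n_0, C_n_n; ring.
- unfold binT.
  rewrite (decomp_sum _ (S (S m))) by lia.
  rewrite (decomp_sum (fun k => a k * _) (S m)) by lia.
  simpl pred; rewrite 2!tech5, !C_n_0, !C_n_n.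
  rewrite (sum_eq (fun i => a (S i) * Binomial.C (S (S m)) (S i))
    (fun i => a (S i) * Binomial.C (S m) i + a (S i) * Binomial.C (S m) (S i))).
  + rewrite sum_plus; ring.
  + intros i Hi; rewrite <- pascal by lia; ring.
Qed.

Lemma sadd_binT (c : R) (a : nat -> R) :
  sadd c (binT a) = binT (sadd (c + 1) a).
Proof.
apply functional_extensionality; intros n; unfold sadd.
rewrite binT_plus, binT_scal, binT_S; ring.
Qed.

Lemma sadd_plus (c : R) (a b : nat -> R) :
  sadd c (fun k => a k + b k) = fun k => sadd c a k + sadd c b k.
Proof. apply functional_extensionality; intros k; unfold sadd; ring. Qed.

Lemma iter_sadd_plus (n : nat) (c : R) (a b : nat -> R) :
  Nat.iter n (sadd c) (fun k => a k + b k) =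
  fun k => Nat.iter n (sadd c) a k + Nat.iter n (sadd c) b k.
Proof.
induction n as [|n IH]; [reflexivity|].
now simpl; rewrite IH, sadd_plus.
Qed.

Lemma iter_sadd_scal (n : nat) (c d : R) (a : nat -> R) :
  Nat.iter n (sadd c) (fun k => d * a k) =
  fun k => d * Nat.iter n (sadd c) a k.
Proof.
induction n as [|n IH]; [reflexivity|].
simpl; rewrite IH; apply functional_extensionality; intros k.
unfold sadd; ring.
Qed.

(** Unrolls the innermost factor, so that an induction on [n] can pass to the shifted sequence. *)
Lemma iter_sadd_S (n : nat) (c : R) (a : nat -> R) :
  Nat.iter (S n) (sadd c) a 0%nat =
  Nat.iter n (sadd c) (fun k => a (S k)) 0%nat +
  c * Nat.iter n (sadd c) a 0%nat.
Proof.
rewrite Nat.iter_succ_r; unfold sadd at 2.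
now rewrite iter_sadd_plus, iter_sadd_scal.
Qed.

Lemma iter_sadd_binT (n : nat) (c : R) (a : nat -> R) :
  Nat.iter n (sadd c) (binT a) = binT (Nat.iter n (sadd (c + 1)) a).
Proof.
induction n as [|n IH]; [reflexivity|].
now simpl; rewrite IH, sadd_binT.
Qed.

Lemma sadd_comm (c d : R) (a : nat -> R) :
  sadd c (sadd d a) = sadd d (sadd c a).
Proof. apply functional_extensionality; intros k; unfold sadd; ring. Qed.

Lemma iter_sadd_comm (m n : nat) (c d : R) (a : nat -> R) :
  Nat.iter m (sadd c) (Nat.iter n (sadd d) a) =
  Nat.iter n (sadd d) (Nat.iter m (sadd c) a).
Proof.
induction m as [|m IHm]; [reflexivity|].
simpl; rewrite IHm; clear IHm.
generalize (Nat.iter m (sadd c) a); intros b.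
induction n as [|n IHn]; [reflexivity|].
now simpl; rewrite sadd_comm, IHn.
Qed.

Lemma iter_sadd_0 (n k : nat) (a : nat -> R) :
  Nat.iter n (sadd 0) a k = a (n + k)%nat.
Proof.
revert k; induction n as [|n IH]; intros k; [reflexivity|].
simpl; unfold sadd at 1; rewrite !IH, Nat.add_succ_r; ring.
Qed.

Lemma iter_sadd_null (n : nat) (c : R) (a : nat -> R) :
  (forall k, a k = 0) -> forall k, Nat.iter n (sadd c) a k = 0.
Proof.
intros Ha; induction n as [|n IH]; intros k; [apply Ha|].
simpl; unfold sadd; rewrite !IH; ring.
Qed.

(** * Integrality *)

Definition is_int (x : R) : Prop := exists z : Z, x = IZR z.

Lemma is_int_plus (x y : R) : is_int x -> is_int y -> is_int (x + y).
Proof. intros [p ->] [q ->]; exists (p + q)%Z; now rewrite plus_IZR. Qed.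

Lemma is_int_opp (x : R) : is_int x -> is_int (- x).
Proof. intros [p ->]; exists (- p)%Z; now rewrite opp_IZR. Qed.

(* [((S+1)^n + (S-1)^n) / 2] and [((S+1)^n - (S-1)^n) / 2] have integral
   coefficients, with leading terms [S^n] and [n S^(n-1)] respectively. *)
Lemma iter_sadd_half (n : nat) (a : nat -> R) :
  (forall k, (k < n)%nat -> is_int (a k)) ->
  is_int ((Nat.iter n (sadd 1) a 0%nat +
           Nat.iter n (sadd (-1)) a 0%nat) / 2 - a n) /\
  is_int ((Nat.iter n (sadd 1) a 0%nat -
           Nat.iter n (sadd (-1)) a 0%nat) / 2).
Proof.
revert a; induction n as [|n IH]; intros a Ha.
- simpl; split; exists 0%Z; field.
(* With [P n] the half sum and [Q n] the half difference, [P (n+1) = S P n + Q n] and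
   [Q (n+1) = S Q n + P n]. *)
- rewrite !iter_sadd_S.
  destruct (IH a) as [H1 H2]; [intros; apply Ha; lia|].
  destruct (IH (fun k => a (S k))) as [H3 H4]; [intros; apply Ha; lia|].
  assert (H5 : is_int (a n)) by (apply Ha; lia).
  split.
  + eapply eq_ind; [exact (is_int_plus _ _ H3 H2)|field].
  + eapply eq_ind;
      [exact (is_int_plus _ _ H4 (is_int_plus _ _ H1 H5))|field].
Qed.

Section Genocchi.

Variable g : nat -> R.
Hypothesis g_even : forall n, g (2 * n + 1)%nat = 0.
Hypothesis g_rec0 : binT g 0 + g 0%nat = 0.
(** The range starts at [2]: for [n = 1] the left side is [0], not [1]. *)
Hypothesis g_rec : forall n, (2 <= n)%nat -> binT g n + g n = INR n.

Lemma g_0 : g 0%nat = 0.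
Proof. rewrite binT_0 in g_rec0; lra. Qed.

Lemma g_1 : g 1%nat = 0.
Proof. exact (g_even 0). Qed.

Lemma g_2 : g 2%nat = 1.
Proof.
generalize (g_rec 2 (le_n _)).
rewrite !binT_S, !binT_0, g_0, g_1; simpl; lra.
Qed.

Lemma iter_sadd_g (n : nat) : (2 <= n)%nat ->
  Nat.iter n (sadd 1) (fun k => g (n + k)%nat) 0%nat +
  Nat.iter n (sadd (-1)) (fun k => g (n + k)%nat) 0%nat = 0.
Proof.
intros Hn.
assert (Hs : (fun k => g (n + k)%nat) = Nat.iter n (sadd 0) g).
{ apply functional_extensionality; intros k; now rewrite iter_sadd_0. }
rewrite Hs.
rewrite iter_sadd_comm.
(* At index [0] the transform [E] is evaluation, so it can be inserted; then [S^n] leaves it as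
   [(S-1)^n] and [(S+1)^n] leaves it as [S^n]. *)
rewrite <- (binT_0 (Nat.iter n (sadd 0) (Nat.iter n (sadd 1) g))).
replace (sadd 0) with (sadd (-1 + 1)) at 1 by (f_equal; ring).
rewrite <- iter_sadd_binT.
replace (sadd 1) with (sadd (0 + 1)) by (f_equal; ring).
rewrite <- iter_sadd_binT.
change (?u 0%nat + ?v 0%nat) with ((fun k => u k + v k) 0%nat).
rewrite <- !iter_sadd_plus.
replace (Nat.iter n (sadd 0) (fun k => binT g k + g k))
  with (fun k => INR (n + k)).
2:{ apply functional_extensionality; intros k.
    rewrite iter_sadd_0, g_rec; [reflexivity|lia]. }
(* Two of the [n] factors [S - 1] already annihilate a linear sequence. *)
destruct n as [|[|n]]; [lia|lia|].
rewrite 2!Nat.iter_succ_r.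
apply iter_sadd_null; intros k; unfold sadd.
rewrite !plus_INR, !S_INR; ring.
Qed.

Lemma g_int (n : nat) : is_int (g n).
Proof.
induction n as [n IH] using lt_wf_ind.
destruct (Nat.Even_or_Odd n) as [[m ->]|[m ->]].
2:{ exists 0%Z; apply g_even. }
destruct m as [|[|m]].
- exists 0%Z; apply g_0.
- exists 1%Z; apply g_2.
- set (p := S (S m)) in *.
  (* Only [g p], ..., [g (2p-1)] need to be integers; the half sum vanishes, which leaves
     [- g (2p)]. *)
  destruct (iter_sadd_half p (fun k => g (p + k)%nat)) as [H _].
  + intros k Hk; apply IH; lia.
  + rewrite iter_sadd_g in H by (unfold p; lia).
    apply is_int_opp in H.
    replace (2 * p)%nat with (p + p)%nat by lia.
    eapply eq_ind; [exact H|field].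
Qed.

(** * Identification with the recurrence of [bG] *)

(* The sequence [c] of the header: [bG] shifted by one index. *)
Definition bGseq (n : nat) : R :=
  match n with 0%nat => 0 | S _ => g (n + 1)%nat + g (n + 2)%nat end.

Lemma binT_unit (n : nat) :
  binT (fun k => match k with 0%nat => 1 | S _ => 0 end) n = 1.
Proof.
induction n as [|n IH]; [now rewrite binT_0|].
rewrite binT_S, IH.
replace (binT _ n) with (0 * binT (fun _ => 0) n); [ring|].
rewrite <- binT_scal; unfold binT; apply sum_eq; intros; ring.
Qed.

(** [E (S+1) S g = S (S-1) E g], and [E g] is [n - g n] from index [2] on. The difference of the
    linear part is the constant [1], cancelled by the correction at index [0]. *)
Lemma binT_bGseq (n : nat) : (1 <= n)%nat ->
  binT bGseq n = g (n + 1)%nat - g (n + 2)%nat.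
Proof.
intros Hn.
(* [c] and [(S+1) S g] differ only at index [0], where the latter is [g 1 + g 2 = 1]. *)
replace bGseq with (fun k => sadd (0 + 1) (sadd (-1 + 1) g) k +
  (-1) * match k with 0%nat => 1 | S _ => 0 end).
2:{ apply functional_extensionality; intros [|k]; unfold sadd, bGseq.
    - rewrite g_1, g_2; ring.
    - rewrite !Nat.add_succ_r, Nat.add_0_r; ring. }
rewrite binT_plus, binT_scal, binT_unit, <- !sadd_binT; unfold sadd.
assert (H1 := g_rec (S n) ltac:(lia)).
assert (H2 := g_rec (S (S n)) ltac:(lia)).
rewrite !Nat.add_succ_r, Nat.add_0_r.
rewrite !S_INR in *; lra.
Qed.

Lemma bG_bGseq (n : nat) : bG n = bGseq (S n).
Proof.
induction n as [n IH] using lt_wf_ind.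
destruct (Nat.le_gt_cases 3 n) as [Hn|Hn].
- rewrite bG_rec by assumption.
  assert (H1 := binT_bGseq n ltac:(lia)).
  assert (H2 := binT_bGseq (S n) ltac:(lia)).
  unfold binT in H1, H2.
  rewrite decomp_sum in H1, H2 by lia.
  destruct n as [|[|n]]; [lia|lia|].
  (* The terms at index [0] are zero since [c 0 = 0]. Each transform goes one term beyond the
     matching sum of the recurrence; the top terms split off are [c n] and [c (n+1)], for the
     original [n]. *)
  simpl pred in H1, H2; rewrite tech5, C_n_n in H1, H2.
  replace (S (S n) - 2)%nat with n by lia.
  replace (S (S n) - 1)%nat with (S n) by lia.
  replace (S (S n) + 1)%nat with (S (S (S n))) by lia.
  rewrite (sum_eq _ (fun i => bGseq (S i) * Binomial.C (S (S n)) (S i)) n),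
    (sum_eq _ (fun i => bGseq (S i) * Binomial.C (S (S (S n))) (S i)) (S n)).
  + unfold bGseq at 1 in H1; unfold bGseq at 1 in H2.
    assert (E1 : bGseq (S (S n)) = g (S (S n) + 1)%nat + g (S (S n) + 2)%nat)
      by reflexivity.
    assert (E2 : bGseq (S (S (S n))) =
      g (S (S (S n)) + 1)%nat + g (S (S (S n)) + 2)%nat) by reflexivity.
    replace (S (S (S n)) + 1)%nat with (S (S n) + 2)%nat in * by lia.
    lra.
  + intros i Hi; rewrite IH by lia; now rewrite Nat.add_1_r.
  + intros i Hi; rewrite IH by lia; now rewrite Nat.add_1_r.
(* The initial values need only [g 2 = 1], [g 3 = g 5 = 0] and [g 4 = -1], the last from
   [6 + 2 g 4 = 4]. *)
- assert (H3 := g_even 1); assert (H5 := g_even 2).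
  assert (H4 := g_rec 4 ltac:(lia)).
  rewrite !binT_S, !binT_0 in H4; simpl in *.
  rewrite g_0, g_1, g_2 in H4.
  destruct n as [|[|[|n]]]; [| | |lia]; rewrite ?bG_0, ?bG_1, ?bG_2; simpl;
    rewrite ?g_2; lra.
Qed.

Lemma bG_int (n : nat) : is_int (bG n).
Proof. rewrite bG_bGseq; apply is_int_plus; apply g_int. Qed.

Lemma bG_even (n : nat) : bG (2 * n) = g (2 * n + 2)%nat.
Proof.
rewrite bG_bGseq; unfold bGseq.
replace (S (2 * n) + 2)%nat with (2 * (n + 1) + 1)%nat by lia.
rewrite g_even, Rplus_0_r; f_equal; lia.
Qed.

End Genocchi.

(** * Derivatives of [Gtilde] *)

(** A class containing [Gtilde] and stable under differentiation, which gives smoothness: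
    [u = 1 / (exp x + 1)] satisfies [u' = u^2 - u]. *)
Inductive expfun : (R -> R) -> Prop :=
| expfun_const c : expfun (fun _ => c)
| expfun_id : expfun (fun x => x)
| expfun_sig : expfun (fun x => / (exp x + 1))
| expfun_plus f h : expfun f -> expfun h -> expfun (fun x => f x + h x)
| expfun_mult f h : expfun f -> expfun h -> expfun (fun x => f x * h x).

Lemma exp_plus_1_neq_0 (x : R) : exp x + 1 <> 0.
Proof. generalize (exp_pos x); lra. Qed.

Lemma expfun_derive (f : R -> R) : expfun f ->
  exists f', expfun f' /\ forall x, is_derive f x (f' x).
Proof.
induction 1 as [c| | |f h _ [f' [Ef Df]] _ [h' [Eh Dh]]
                   |f h Cf [f' [Ef Df]] Ch [h' [Eh Dh]]].
- exists (fun _ => 0); split; [constructor|].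
  intros x; apply (is_derive_const c x).
- exists (fun _ => 1); split; [constructor|].
  intros x; apply (is_derive_id x).
- exists (fun x => / (exp x + 1) * / (exp x + 1) + -1 * / (exp x + 1)).
  split; [repeat constructor|].
  intros x; assert (H := exp_plus_1_neq_0 x).
  auto_derive; [assumption|field; assumption].
- exists (fun x => f' x + h' x); split; [now constructor|].
  intros x; apply (is_derive_plus f h x); auto.
- exists (fun x => f' x * h x + f x * h' x).
  split; [now repeat constructor|].
  intros x; apply (is_derive_mult f h x); auto.
  intros; apply Rmult_comm.
Qed.

Lemma expfun_Derive_n (f : R -> R) (n : nat) :
  expfun f -> expfun (Derive_n f n).
Proof.
intros Hf; induction n as [|n IH]; [exact Hf|].
destruct (expfun_derive _ IH) as [f' [Ef Df]].
replace (Derive_n f (S n)) with f'; [assumption|].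
apply functional_extensionality; intros x; symmetry.
apply is_derive_unique, Df.
Qed.

Lemma is_derive_Derive_n (f : R -> R) (n : nat) (x : R) :
  expfun f -> is_derive (Derive_n f n) x (Derive_n f (S n) x).
Proof.
intros Hf; destruct (expfun_derive _ (expfun_Derive_n f n Hf)) as [f' [_ Df]].
apply Derive_correct; exists (f' x); apply Df.
Qed.

(** [F] is a tower of successive derivatives, quantified after [n] because the induction also uses
    the shifted tower. *)
Lemma is_derive_binT (n : nat) : forall (F : nat -> R -> R) (x : R),
  (forall k y, is_derive (F k) y (F (S k) y)) ->
  is_derive (fun y => binT (fun k => F k y) n) x (binT (fun k => F (S k) x) n).
Proof.
induction n as [|n IH]; intros F x HF.
- rewrite binT_0; apply is_derive_ext with (f := F 0%nat); [|apply HF].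
  intros y; now rewrite binT_0.
- rewrite binT_S.
  apply is_derive_ext with
    (f := fun y => binT (fun k => F (S k) y) n + binT (fun k => F k y) n).
  + intros y; now rewrite binT_S.
  + apply (is_derive_plus
      (fun y => binT (fun k => F (S k) y) n) (fun y => binT (fun k => F k y) n)).
    * apply (IH (fun k => F (S k))); intros; apply HF.
    * now apply IH.
Qed.

(** Leibniz's rule for a product with [exp], one order at a time: [exp] contributes [E F], the tower
    contributes [E S F], and [binT_S] merges them. *)
Lemma is_derive_exp_binT (F : nat -> R -> R) (n : nat) (x : R) :
  (forall k y, is_derive (F k) y (F (S k) y)) ->
  is_derive (fun y => exp y * binT (fun k => F k y) n) x
    (exp x * binT (fun k => F k x) (S n)).
Proof.
intros HF; rewrite binT_S.
replace (exp x * _) with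
  (exp x * binT (fun k => F k x) n + exp x * binT (fun k => F (S k) x) n)
  by ring.
apply (is_derive_mult exp (fun y => binT (fun k => F k y) n) x).
- apply is_derive_exp.
- now apply is_derive_binT.
- intros; apply Rmult_comm.
Qed.

Lemma expfun_Gtilde : expfun Gtilde.
Proof.
replace Gtilde with (fun x => x * (1 + -2 * / (exp x + 1))).
- repeat constructor.
- apply functional_extensionality; intros x; unfold Gtilde; field.
  apply exp_plus_1_neq_0.
Qed.

(* The [n]-th derivative of [(exp x + 1) Gtilde x = x (exp x - 1)]. *)
Lemma Gtilde_leibniz (n : nat) (x : R) :
  exp x * binT (fun k => Derive_n Gtilde k x) n + Derive_n Gtilde n x =
  exp x * (x + INR n) - match n with 0%nat => x | 1%nat => 1 | _ => 0 end.
Proof.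
revert x; induction n as [|n IH]; intros x.
- rewrite binT_0; simpl; unfold Gtilde; field; apply exp_plus_1_neq_0.
- assert (D : forall k y,
    is_derive (Derive_n Gtilde k) y (Derive_n Gtilde (S k) y))
    by (intros; apply is_derive_Derive_n, expfun_Gtilde).
  (* The left side is the derivative of the left side of [IH], so only the right side of [IH]
     remains to be differentiated. *)
  etransitivity.
  { symmetry; exact (is_derive_unique _ _ _ (is_derive_plus _ _ _ _ _
      (is_derive_exp_binT (Derive_n Gtilde) n x D) (D n x))). }
  apply is_derive_unique.
  eapply is_derive_ext; [intros y; symmetry; apply IH|].
  rewrite S_INR.
  destruct n as [|[|n]]; auto_derive; trivial; simpl INR; ring.
Qed.

Lemma Gtilde_opp (x : R) : Gtilde (- x) = Gtilde x.
Proof.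
unfold Gtilde; rewrite exp_Ropp; field.
generalize (exp_pos x); lra.
Qed.

Lemma Derive_n_Gtilde_odd (n : nat) : Derive_n Gtilde (2 * n + 1) 0 = 0.
Proof.
assert (H : Derive_n (fun y => Gtilde (- y)) (2 * n + 1) 0 =
  (-1) ^ (2 * n + 1) * Derive_n Gtilde (2 * n + 1) (- 0)).
{ apply Derive_n_comp_opp, filter_forall; intros y [|k] _; [exact I|].
  eexists; apply is_derive_Derive_n, expfun_Gtilde. }
rewrite (Derive_n_ext _ Gtilde), Ropp_0 in H by apply Gtilde_opp.
rewrite Nat.add_1_r, pow_1_odd in H; rewrite Nat.add_1_r; lra.
Qed.

Lemma Gtilde_rec0 :
  binT (fun k => Derive_n Gtilde k 0) 0 + Derive_n Gtilde 0 0 = 0.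
Proof.
generalize (Gtilde_leibniz 0 0); rewrite exp_0; simpl INR; lra.
Qed.

Lemma Gtilde_rec (n : nat) : (2 <= n)%nat ->
  binT (fun k => Derive_n Gtilde k 0) n + Derive_n Gtilde n 0 = INR n.
Proof.
intros Hn; generalize (Gtilde_leibniz n 0); rewrite exp_0.
destruct n as [|[|n]]; [lia|lia|lra].
Qed.

Lemma Gtilde_tanh (x : R) : Gtilde x = x * tanh (x / 2).
Proof.
unfold Gtilde, tanh, sinh, cosh.
replace (exp x) with (exp (x / 2) * exp (x / 2))
  by (rewrite <- exp_plus; f_equal; field).
rewrite exp_Ropp; assert (H := exp_pos (x / 2)).
field; repeat split; nra.
Qed.

Theorem mainTheorem8 :
  (forall n : nat, exists z : Z, bG n = IZR z) /\
  (forall x : R, Gtilde x = x * tanh (x / 2)) /\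
  (forall n : nat, (1 <= n)%nat ->
     is_derive_n Gtilde (2 * n - 1) 0 0 /\
     is_derive_n Gtilde (2 * n) 0 (bG (2 * n - 2))).
Proof.
assert (D : forall n, (1 <= n)%nat ->
  is_derive_n Gtilde n 0 (Derive_n Gtilde n 0)).
{ intros [|n] Hn; [lia|]; apply is_derive_Derive_n, expfun_Gtilde. }
split; [|split].
- intros n.
  exact (bG_int _ Derive_n_Gtilde_odd Gtilde_rec0 Gtilde_rec n).
- exact Gtilde_tanh.
- intros n Hn; split.
  + generalize (Derive_n_Gtilde_odd (n - 1)) (D (2 * (n - 1) + 1)%nat).
    replace (2 * (n - 1) + 1)%nat with (2 * n - 1)%nat by lia.
    intros -> H; apply H; lia.
  + replace (2 * n - 2)%nat with (2 * (n - 1))%nat by lia.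
    rewrite (bG_even _ Derive_n_Gtilde_odd Gtilde_rec0 Gtilde_rec).
    replace (2 * (n - 1) + 2)%nat with (2 * n)%nat by lia.
    apply D; lia.
Qed.
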